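(* Let the temporal mesh be uniform, with step size $\tau=T/M$, and let $(\phi^{k},R^{k})_{k=0}^{M}$ be a solution of the L1-CN scheme described in the context. Then the scheme is unconditionally stable in the sense that a discrete energy is always bounded during the time stepping. More precisely, for every $\tau$, $$\widetilde{E}^{n}_{\varepsilon,\theta}\le\widetilde{E}^{0}_{\varepsilon,\theta},\qquad n=1,2,\dots,M,$$ where the discrete energy $\widetilde{E}^{n}_{\varepsilon,\theta}$ is defined (with $\phi^{-1}:=\phi^{0}$) by $$\widetilde{E}^{n}_{\varepsilon,\theta}:=\frac{\varepsilon^{2}-\theta}{2}\|\nabla\phi^{n}\|^{2}_{0}+\frac{\theta}{4}\|\nabla(\phi^{n}-\phi^{n-1})\|_{0}^{2}+|R^{n}|^{2}.$$
   Context: Setting. $0<\alpha<1$, $\varepsilon>0$, $0\le\theta\le\varepsilon^2$, $T>0$, and $\Omega\subset\mathbb{R}^{d}$ ($d=1,2,3$) is a bounded domain. $(\cdot,\cdot)$ and $\|\cdot\|_0$ are the inner product and norm of $L^2(\Omega)$. $F:\mathbb{R}\to\mathbb{R}$ is the (differentiable) nonlinear free energy density. Define $$E_\theta(\phi):=\int_\Omega\Big[\frac{\theta}{2}|\nabla\phi|^2+F(\phi)\Big]d\mathbf{x}.$$ Standing assumption: $E_\theta$ is bounded from below, and $C_0$ is a constant such that $E_\theta(\phi)+C_0>0$ for all admissible $\phi$. The scheme approximates the time fractional Allen-Cahn equation ${}^{C}_{0}D^{\alpha}_{t}\phi-\varepsilon^{2}\Delta\phi+F'(\phi)=0$ in $(0,T]\times\Omega$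 (${}^{C}_{0}D^{\alpha}_{t}$ is the Caputo derivative) with initial value $\phi(\mathbf{x},0)=\phi_0(\mathbf{x})$ and either homogeneous Neumann boundary condition $\partial\phi/\partial\mathbf{n}|_{\partial\Omega}=0$ or periodic boundary conditions. It is discrete in time only. Uniform mesh: $M$ is a positive integer, $\tau=T/M$, $t_n=n\tau$. The discrete fractional operator is $$L^{\alpha}_{n+\frac12}\phi:=\sum_{k=0}^{n}\widetilde{b}_{n-k}\frac{\phi^{k+1}-\phi^{k}}{\tau},$$ $$\widetilde{b}_{0}=\frac{\tau^{1-\alpha}}{\Gamma(2-\alpha)2^{1-\alpha}},\qquad \widetilde{b}_{k}=\frac{\tau^{1-\alpha}}{\Gamma(2-\alpha)}\Big[\big(k+\tfrac12\big)^{1-\alpha}-\big(k-\tfrac12\big)^{1-\alpha}\Big],\ k\ge1.$$ L1-CN scheme: $\phi^{-1}:=\phi^0=\phi_0$, $R^0=\sqrt{E_\theta(\phi_0)+C_0}$, and for $n=0,1,\dots,M-1$, with $\phi^{n+\frac12}:=\phi^n+\frac12(\phi^n-\phi^{n-1})$ and $E_\theta^{n+\frac12}:=E_\theta(\phi^{n+\frac12})$, the function $\phi^{n+1}$ (satisfying the same Neumann or periodic boundary condition) and the real number $R^{n+1}$ satisfy $$L^{\alpha}_{n+\frac12}\phi-\varepsilon^{2}\frac{\Delta(\phi^{n+1}+\phi^{n})}{2}+\Big(1-\frac{R^{n+1}+R^{n}}{2\sqrt{E_{\theta}^{n+\frac{1}{2}}+C_{0}}}\Big)\theta\Delta\phi^{n+\frac{1}{2}}+\frac{R^{n+1}+R^{n}}{2\sqrt{E_{\theta}^{n+\frac{1}{2}}+C_{0}}}F'(\phi^{n+\frac{1}{2}})=0,$$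 $$\frac{R^{n+1}-R^{n}}{\tau}=\frac{1}{2\sqrt{E_{\theta}^{n+\frac{1}{2}}+C_{0}}}\int_{\Omega}\big(-\theta\Delta\phi^{n+\frac{1}{2}}+F'(\phi^{n+\frac{1}{2}})\big)\frac{\phi^{n+1}-\phi^{n}}{\tau}\,d\mathbf{x}.$$ All $\phi^n$ are understood to be regular enough for these equations to make sense in $L^2(\Omega)$ (e.g. $\phi^n\in H^2(\Omega)$ satisfying the boundary condition, $F'(\phi^{n+\frac12})\in L^2(\Omega)$). *)

(* Defs.v *)
From HB Require Import structures.
From mathcomp Require Import all_boot all_order all_algebra.
From mathcomp Require Import all_classical all_reals all_analysis.
Set Implicit Arguments.
Unset Strict Implicit.
Unset Printing Implicit Defensive.
Import Order.TTheory GRing.Theory Num.Theory.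
Import numFieldNormedType.Exports.
Local Open Scope classical_set_scope.
Local Open Scope ring_scope.

(* R^d is 'rV[R]_d with the sigma-algebra generated by the coordinates, which
   is the Borel one. *)
Fact rV_display : measure_display.
Proof. exact: default_measure_display. Qed.

Section measurable_rV.
Context (R : realType) (d : nat).

Definition rV_coord (i : 'I_d) (x : 'rV[R]_d) : measurableTypeR R := x ord0 i.

Let rV_set0 : g_sigma_preimage rV_coord set0.
Proof. exact: sigma_algebra0. Qed.

Let rV_setC A : g_sigma_preimage rV_coord A -> g_sigma_preimage rV_coord (~` A).
Proof. exact: sigma_algebraC. Qed.

Let rV_bigcup (F : _^nat) : (forall i, g_sigma_preimage rV_coord (F i)) ->
  g_sigma_preimage rV_coord (\bigcup_i (F i)).
Proof. exact: sigma_algebra_bigcup. Qed.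

HB.instance Definition _ := @isMeasurable.Build rV_display
  'rV[R]_d (g_sigma_preimage rV_coord) rV_set0 rV_setC rV_bigcup.

Lemma measurable_rV_coord (i : 'I_d) : measurable_fun [set: 'rV[R]_d] (rV_coord i).
Proof.
move=> _ Y mY; rewrite setTI; apply: sub_sigma_algebra => /=.
rewrite -bigcup_seq/=; exists i => /=; first by rewrite mem_index_enum.
by exists Y => //; rewrite setTI.
Qed.

Lemma measurable_fun_rVP d1 (T1 : measurableType d1) (f : T1 -> 'rV[R]_d) :
  (forall i, measurable_fun [set: T1] (rV_coord i \o f)) ->
  measurable_fun [set: T1] f.
Proof.
move=> mf _ A mA; rewrite setTI.
have : preimage_set_system [set: T1] f (g_sigma_preimage rV_coord) (f @^-1` A).
  by exists A => //; rewrite setTI.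
rewrite -g_sigma_preimage_comp.
apply: smallest_sub; first exact: sigma_algebra_measurable.
rewrite -bigcup_seq => B [i _ [C mC <-]].
by apply: mf.
Qed.

End measurable_rV.

Lemma product_sigma_finite d1 d2 (T1 : measurableType d1)
    (T2 : measurableType d2) (R : realType)
    (m1 : {sigma_finite_measure set T1 -> \bar R})
    (m2 : {sigma_finite_measure set T2 -> \bar R}) :
  sigma_finite setT (m1 \x m2)%E.
Proof.
have /sigma_finiteP[F [TF ndF Foo]] := sigma_finiteT m1.
have /sigma_finiteP[G [TG ndG Goo]] := sigma_finiteT m2.
exists (fun n => F n `*` G n).
  rewrite -setXTT TF TG predeqE => -[x y]; split.
    move=> [/= [n _ Fnx] [k _ Gky]]; exists (maxn n k) => //; split.
    - by move: x Fnx; exact/subsetPset/ndF/leq_maxl.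
    - by move: y Gky; exact/subsetPset/ndG/leq_maxr.
  by move=> [n _ []/= ? ?]; split; exists n.
move=> k; have [? ?] := Foo k; have [? ?] := Goo k.
split; first exact: measurableX.
by rewrite product_measure1E// lte_mul_pinfty// ge0_fin_numE.
Qed.

Section lebesgue_rV.
Context (R : realType).

Definition rV_cons (d : nat) (p : measurableTypeR R * 'rV[R]_d) : 'rV[R]_d.+1 :=
  row_mx (const_mx p.1 : 'rV_1) p.2.

Lemma measurable_rV_cons d : measurable_fun [set: _] (@rV_cons d).
Proof.
apply: measurable_fun_rVP => i.
case: (@split_ordP 1 d i) => j ->.
- rewrite (_ : _ \o _ = fst); first exact: measurable_fst.
  by apply/funext => p; rewrite /rV_coord /rV_cons /comp (@row_mxEl R 1 1 d) mxE.
- rewrite (_ : _ \o _ = rV_coord j \o snd).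
    apply: measurableT_comp; first exact: measurable_rV_coord.
    exact: measurable_snd.
  by apply/funext => p; rewrite /rV_coord /rV_cons /comp (@row_mxEr R 1 1 d).
Qed.

Definition rV_uncons (d : nat) (x : 'rV[R]_d.+1) :
  measurableTypeR R * 'rV[R]_d := (x ord0 ord0, @rsubmx R 1 1 d x).

Lemma measurable_rV_uncons d : measurable_fun [set: _] (@rV_uncons d).
Proof.
apply: measurable_fun_pair; first exact: (measurable_rV_coord ord0).
apply: measurable_fun_rVP => i.
rewrite (_ : _ \o _ = rV_coord (rshift 1 i)); first exact: measurable_rV_coord.
by apply/funext => x; rewrite /rV_coord /= mxE.
Qed.

Lemma rV_consK d : cancel (@rV_cons d) (@rV_uncons d).
Proof.
move=> [a x]; rewrite /rV_uncons /rV_cons /=; congr (_, _); last first.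
  by rewrite row_mxKr.
rewrite (_ : ord0 = lshift d (ord0 : 'I_1)); last exact: val_inj.
by rewrite (@row_mxEl R 1 1 d) mxE.
Qed.

Section step.
Context (d : nat) (mu : {sigma_finite_measure set 'rV[R]_d -> \bar R}).

Definition lebesgue_step : set 'rV[R]_d.+1 -> \bar R :=
  pushforward (@lebesgue_measure R \x mu)%E (@rV_cons d).

Let step0 : lebesgue_step set0 = 0%E.
Proof. by rewrite /lebesgue_step /pushforward preimage_set0 measure0. Qed.

Let step_ge0 A : (0 <= lebesgue_step A)%E.
Proof. by rewrite /lebesgue_step /pushforward. Qed.

Let step_sigma_additive : semi_sigma_additive lebesgue_step.
Proof.
move=> F mF tF mUF; rewrite /lebesgue_step /pushforward preimage_bigcup.
apply: measure_semi_sigma_additive.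
- move=> n; rewrite -[X in measurable X]setTI.
  exact: measurable_rV_cons.
- apply/trivIsetP => /= i j _ _ ij; rewrite -preimage_setI.
  by move/trivIsetP : tF => /(_ _ _ _ _ ij) ->//; rewrite preimage_set0.
- rewrite -preimage_bigcup -[X in measurable X]setTI.
  exact: measurable_rV_cons.
Qed.

HB.instance Definition _ := isMeasure.Build _ _ _ lebesgue_step
  step0 step_ge0 step_sigma_additive.

Let step_sigma_finite : sigma_finite setT lebesgue_step.
Proof.
have [F UF mF] : sigma_finite setT (@lebesgue_measure R \x mu)%E.
  exact: product_sigma_finite.
exists (fun n => (@rV_uncons d) @^-1` F n).
  by rewrite -preimage_bigcup -UF preimage_setT.
move=> n; have [mFn Foo] := mF n; split.
  by rewrite -[X in measurable X]setTI; exact: measurable_rV_uncons.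
rewrite /lebesgue_step /pushforward -comp_preimage.
rewrite (_ : _ \o _ = id); first by rewrite preimage_id.
by apply/funext => p /=; rewrite rV_consK.
Qed.

HB.instance Definition _ := Measure_isSigmaFinite.Build _ _ _ lebesgue_step
  step_sigma_finite.

End step.
End lebesgue_rV.

(* The measure on 'rV_0 is the unit mass, so this is the d-fold product of the
   Lebesgue measure on R. *)
Fixpoint lebesgue_rV (R : realType) (d : nat) :
    {sigma_finite_measure set 'rV[R]_d -> \bar R} :=
  match d with
  | 0 => \d_(0 : 'rV[R]_0)
  | d'.+1 => lebesgue_step (lebesgue_rV R d')
  end.

Section spaces.
Context (R : realType) (d : nat).
Implicit Types (Omega : set 'rV[R]_d) (u v g f : 'rV[R]_d -> R) (i j : 'I_d).

Local Notation mu := (lebesgue_rV R d).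

Definition bounded_domain Omega :=
  [/\ open Omega, connected Omega, bounded_set Omega & Omega !=set0].

Definition in_L2 Omega u :=
  measurable_fun Omega u /\ mu.-integrable Omega (fun x => (u x ^+ 2)%:E).

Definition basis_vector i : 'rV[R]_d := delta_mx ord0 i.

Definition partial i f : 'rV[R]_d -> R := 'D_(basis_vector i) f.

Fixpoint C_k (k : nat) f : Prop :=
  match k with
  | 0 => continuous f
  | k'.+1 => continuous f /\
      forall i, (forall x, derivable f x (basis_vector i)) /\ C_k k' (partial i f)
  end.

Definition smooth f := forall k, C_k k f.

Definition test_function Omega f :=
  smooth f /\ exists K, [/\ compact K, K `<=` Omega & forall x, ~ K x -> f x = 0].

Definition weak_partial Omega i u g :=
  forall psi, test_function Omega psi ->
    \int[mu]_(x in Omega) (u x * partial i psi x) =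
    - \int[mu]_(x in Omega) (g x * psi x).

Definition in_H1 Omega u (g : 'I_d -> 'rV[R]_d -> R) :=
  in_L2 Omega u /\ forall i, in_L2 Omega (g i) /\ weak_partial Omega i u (g i).

(* A function carried together with (representatives of) its weak derivatives
   up to order two. Weak derivatives being unique up to null sets, an element w
   of H^2(Omega) is the same as a w with [in_H2 Omega w]; carrying them along
   makes the gradient and the Laplacian plain operations. *)
Record jet2 := Jet2 {
  fval : 'rV[R]_d -> R;
  grad : 'I_d -> 'rV[R]_d -> R;
  hess : 'I_d -> 'I_d -> 'rV[R]_d -> R }.

Definition in_H2 Omega (w : jet2) :=
  in_H1 Omega (fval w) (grad w) /\ forall i, in_H1 Omega (grad w i) (hess w i).

Definition lap (w : jet2) : 'rV[R]_d -> R := fun x => \sum_(i < d) hess w i i x.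

Definition jet_add (w1 w2 : jet2) := Jet2
  (fun x => fval w1 x + fval w2 x)
  (fun i x => grad w1 i x + grad w2 i x)
  (fun i j x => hess w1 i j x + hess w2 i j x).

Definition jet_scale (c : R) (w : jet2) := Jet2
  (fun x => c * fval w x)
  (fun i x => c * grad w i x)
  (fun i j x => c * hess w i j x).

Definition jet_sub (w1 w2 : jet2) := jet_add w1 (jet_scale (- 1) w2).

Definition L2_norm_sq Omega u := \int[mu]_(x in Omega) (u x ^+ 2).

Definition grad_sq (w : jet2) (x : 'rV[R]_d) := \sum_(i < d) grad w i x ^+ 2.

Definition grad_norm_sq Omega (w : jet2) := \int[mu]_(x in Omega) grad_sq w x.

(* Periodic boundary conditions are posed on the open box with corners a and b,
   with period b_i - a_i in the direction i. *)
Variant boundary_condition :=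
  | Neumann
  | Periodic of 'rV[R]_d & 'rV[R]_d.

Definition open_box (a b : 'rV[R]_d) : set 'rV[R]_d :=
  [set x | forall i, a ord0 i < x ord0 i < b ord0 i].

Definition compatible_domain Omega (bc : boundary_condition) :=
  match bc with
  | Neumann => True
  | Periodic a b => (forall i, a ord0 i < b ord0 i) /\ Omega = open_box a b
  end.

(* The normal trace of a vector field p in H(div, Omega) with divergence q, as
   a functional of v in H^1(Omega) with gradient dv; on a Lipschitz domain it
   is the integral of (p . n) v over the boundary. *)
Definition normal_trace Omega (p : 'I_d -> 'rV[R]_d -> R) (q : 'rV[R]_d -> R)
    v (dv : 'I_d -> 'rV[R]_d -> R) : R :=
  \int[mu]_(x in Omega) (q x * v x + \sum_(i < d) p i x * dv i x).

(* The domain has no prescribed boundary regularity, so d(w)/dn = 0 is the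
   vanishing of the normal trace of grad w. *)
Definition neumann_bc Omega (w : jet2) :=
  forall v dv, in_H1 Omega v dv -> normal_trace Omega (grad w) (lap w) v dv = 0.

Definition periodic_fun (a b : 'rV[R]_d) f :=
  forall x i, f (x + (b ord0 i - a ord0 i) *: basis_vector i) = f x.

(* H^2_per as the closure, in the norm of H^2(Omega), of the smooth periodic
   functions on R^d. *)
Definition periodic_bc Omega (a b : 'rV[R]_d) (w : jet2) :=
  exists u : nat -> 'rV[R]_d -> R,
  [/\ forall k, smooth (u k) /\ periodic_fun a b (u k),
      L2_norm_sq Omega (fun x => u k x - fval w x) @[k --> \oo] --> 0,
      forall i, L2_norm_sq Omega
        (fun x => partial i (u k) x - grad w i x) @[k --> \oo] --> 0 &
      forall i j, L2_norm_sq Omega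
        (fun x => partial j (partial i (u k)) x - hess w i j x)
        @[k --> \oo] --> 0].

Definition in_H2_bc Omega (bc : boundary_condition) (w : jet2) :=
  in_H2 Omega w /\
  match bc with
  | Neumann => neumann_bc Omega w
  | Periodic a b => periodic_bc Omega a b w
  end.

Definition energy Omega (F : R -> R) (theta : R) (w : jet2) : R :=
  \int[mu]_(x in Omega) (theta / 2 * grad_sq w x + F (fval w x)).

(* Integrability of F(w) is required because the real-valued integral in
   [energy] is total: it would have a junk value otherwise. *)
Definition admissible Omega (bc : boundary_condition) (F : R -> R) (w : jet2) :=
  in_H2_bc Omega bc w /\ mu.-integrable Omega (fun x => (F (fval w x))%:E).

Definition Gamma (z : R) : R :=
  \int[@lebesgue_measure R]_(t in `]0, +oo[%classic) (t `^ (z - 1) * expR (- t)).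

Definition btilde (alpha tau : R) (k : nat) : R :=
  if k is 0 then tau `^ (1 - alpha) / (Gamma (2 - alpha) * 2 `^ (1 - alpha))
  else tau `^ (1 - alpha) / Gamma (2 - alpha) *
       ((k%:R + 1 / 2) `^ (1 - alpha) - (k%:R - 1 / 2) `^ (1 - alpha)).

Definition frac_op (alpha tau : R) (phi : nat -> jet2) (n : nat)
    (x : 'rV[R]_d) : R :=
  \sum_(k < n.+1) btilde alpha tau (n - k) *
    ((fval (phi k.+1) x - fval (phi k) x) / tau).

(* phi^{n-1}; as 0.-1 = 0, this includes the convention phi^{-1} = phi^0. *)
Definition prev (phi : nat -> jet2) (n : nat) : jet2 := phi n.-1.

Definition phi_half (phi : nat -> jet2) (n : nat) : jet2 :=
  jet_add (phi n) (jet_scale (1 / 2) (jet_sub (phi n) (prev phi n))).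

Record L1CN_solution Omega (bc : boundary_condition)
    (alpha eps theta tau C0 : R) (F : R -> R) (M : nat)
    (phi0 : jet2) (phi : nat -> jet2) (r : nat -> R) : Prop := {
  L1CN_phi0 : phi 0%N = phi0;
  L1CN_r0 : r 0%N = Num.sqrt (energy Omega F theta phi0 + C0);
  L1CN_H2 : forall n, (n <= M)%N -> in_H2_bc Omega bc (phi n);
  L1CN_F : forall n, (n < M)%N ->
    mu.-integrable Omega (fun x => (F (fval (phi_half phi n) x))%:E);
  L1CN_dF : forall n, (n < M)%N ->
    in_L2 Omega (fun x => derive1 F (fval (phi_half phi n) x));
  L1CN_phi : forall n, (n < M)%N ->
    let w := phi_half phi n in
    let q := (r n.+1 + r n) / (2 * Num.sqrt (energy Omega F theta w + C0)) in
    {ae mu, forall x, Omega x ->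
      frac_op alpha tau phi n x
      - eps ^+ 2 * (lap (jet_add (phi n.+1) (phi n)) x / 2)
      + (1 - q) * theta * lap w x
      + q * derive1 F (fval w x) = 0};
  L1CN_r : forall n, (n < M)%N ->
    let w := phi_half phi n in
    (r n.+1 - r n) / tau =
    1 / (2 * Num.sqrt (energy Omega F theta w + C0)) *
    \int[mu]_(x in Omega) ((- theta * lap w x + derive1 F (fval w x)) *
                           ((fval (phi n.+1) x - fval (phi n) x) / tau)) }.

Definition discrete_energy Omega (eps theta : R) (phi : nat -> jet2)
    (r : nat -> R) (n : nat) : R :=
  (eps ^+ 2 - theta) / 2 * grad_norm_sq Omega (phi n)
  + theta / 4 * grad_norm_sq Omega (jet_sub (phi n) (prev phi n))
  + `|r n| ^+ 2.

End spaces.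

Arguments Neumann {R d}.

(* Main.v *)
Require Import Defs.
From mathcomp Require Import all_boot all_order all_algebra.
From mathcomp Require Import all_classical all_reals all_analysis.
From mathcomp Require Import measurable_realfun ring lra.
Import Order.TTheory GRing.Theory Num.Theory.
Import numFieldNormedType.Exports.
Local Open Scope classical_set_scope.
Local Open Scope ring_scope.

(** Test the evolution equation at step [n] with the increment
[delta^n = phi^{n+1} - phi^n]. Green's identity turns the diffusion into the
increment of [eps^2 / 2 |grad phi|^2], and multiplying the equation for [r] by
[r^{n+1} + r^n] shows that the term carrying the factor
[(r^{n+1} + r^n) / (2 sqrt (E + C0))] is [|r^{n+1}|^2 - |r^n|^2]. What remains is
the extrapolated term [theta Delta phi^{n+1/2}]; completing the square with the
gradient of [phi^{n+1} - 2 phi^n + phi^{n-1}] yields [energy_step]: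
  [E~^{n+1} + (L phi, delta^n) <= E~^n].

The fractional term has no sign at a single step, but its sum over the steps has
([dissipation_ge0]). Pointwise in space that sum is, up to the factor [1 / tau],
the quadratic form [sum_n delta^n sum_(k <= n) b_{n-k} delta^k]. The sequence
[2 b_0, b_1, b_2, ...] is nonnegative, nonincreasing and convex, since the [b_k]
are increments of the concave function [x ^ (1 - alpha)], whose derivative is
convex; the entries with small index, where the half-integer grid meets [0],
need a separate numerical inequality ([mid_incr_convex]). A convolution form
with such a kernel is nonnegative ([convex_kernel_ge0]), and summing
[energy_step] concludes.

Green's identity ([green_identity]) is where the boundary conditions enter. The
Neumann condition provides it directly, as the vanishing of a normal trace. In
the periodic case it is proved for smooth periodic functions, by Fubini and the
fundamental theorem of calculus along lines, and passes to the limit in L2. *)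

(** * Positivity of convex convolution kernels *)

Lemma summation_by_parts (R : comPzRingType) (c s : nat -> R) (N : nat) :
  \sum_(k < N.+1) c k * (s k - s k.+1) =
  c 0%N * s 0%N - c N * s N.+1 + \sum_(j < N) (c j.+1 - c j) * s j.+1.
Proof.
elim: N => [|N IH]; first by rewrite big_ord_recr !big_ord0 /=; ring.
by rewrite big_ord_recr /= IH [in RHS]big_ord_recr /=; ring.
Qed.

Section convex_kernel.
Context {R : realFieldType}.
Variable a : nat -> R.
Hypothesis a_ge0 : forall k, 0 <= a k.
Hypothesis a_decr : forall k, a k.+1 <= a k.
Hypothesis a_convex : forall k, a k.+1 - a k.+2 <= a k - a k.+1.

(** Weights [a N] and [a m - a m.+1] on the squares of all the tail sums of
[x 0, ..., x N]: nonnegative for a nonincreasing kernel, and such that the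
last term of twice the convolution form dominates the increment of this quantity. *)
Definition kernel_energy (x : nat -> R) (N : nat) : R :=
  a N * (\sum_(0 <= i < N.+1) x i) ^+ 2 +
  \sum_(j < N) (a (N - j)%N.-1 - a (N - j)%N) * (\sum_(j.+1 <= i < N.+1) x i) ^+ 2.

Lemma kernel_energy_ge0 x N : 0 <= kernel_energy x N.
Proof.
apply: addr_ge0; first by rewrite mulr_ge0 ?sqr_ge0.
apply: sumr_ge0 => j _; rewrite mulr_ge0 ?sqr_ge0 // subr_ge0.
by have := ltn_ord j; rewrite -subn_gt0; case: (N - j)%N => //= m _; exact: a_decr.
Qed.

(** Write [s k] for the tail sums up to [N] and [y] for the new entry. Abel
summation turns the convolution into the sum of the
[(a (N - j) - a (N - j).+1) s j.+1] plus [a N.+1 * s 0], and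
[2 y s = (s + y) ^ 2 - s ^ 2 - y ^ 2] exhibits the tail sums up to [N.+1]. The
terms in [y ^ 2] cancel by telescoping; what is left are the decreases of the
weights attached to the squares [s k ^ 2], nonnegative by monotonicity and
convexity of [a]. *)
Lemma kernel_energy_step x N : kernel_energy x N.+1 <= kernel_energy x N +
  2 * (x N.+1 * (a 0%N / 2 * x N.+1 + \sum_(k < N.+1) a (N.+1 - k)%N * x k)).
Proof.
pose y := x N.+1; pose s k := \sum_(k <= i < N.+1) x i.
have sS k : (k <= N.+1)%N -> \sum_(k <= i < N.+2) x i = s k + y.
  by move=> kN; rewrite big_nat_recr.
have s_diff k : (k <= N)%N -> x k = s k - s k.+1.
  by move=> kN; rewrite /s big_ltn // addrK.
have sN : s N.+1 = 0 by rewrite /s big_geq.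
have -> : \sum_(k < N.+1) a (N.+1 - k)%N * x k =
    a N.+1 * s 0%N + \sum_(j < N) (a (N - j)%N - a (N - j)%N.+1) * s j.+1.
  under eq_bigr => k _ do rewrite (s_diff _ (ltn_ord k)).
  rewrite (summation_by_parts _ (fun k => a (N.+1 - k)%N)) sN mulr0 subr0 subn0.
  by congr (_ + _); apply: eq_bigr => j _; rewrite subSS subSn // ltnW.
have telescope : \sum_(j < N.+1) (a (N - j)%N - a (N - j)%N.+1) = a 0%N - a N.+1.
  rewrite (reindex_inj rev_ord_inj) /=.
  under eq_bigr => j _ do rewrite subSS (subKn (ltn_ord j : (j <= N)%N)).
  elim: N.+1 => [|m IH]; first by rewrite big_ord0 subrr.
  by rewrite big_ord_recr /= IH; ring.
rewrite /kernel_energy sS // -/y -/(s 0%N).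
under eq_bigr => j _ do rewrite (subSn (ltn_ord j : (j <= N)%N)) sS //=.
under [X in _ <= _ + X + _]eq_bigr => j _ do rewrite -/(s j.+1).
have -> : \sum_(j < N.+1) (a (N - j)%N - a (N - j)%N.+1) * (s j.+1 + y) ^+ 2 =
  \sum_(j < N) (a (N - j)%N - a (N - j)%N.+1) * s j.+1 ^+ 2 +
  2 * y * (\sum_(j < N) (a (N - j)%N - a (N - j)%N.+1) * s j.+1) +
  y ^+ 2 * (a 0%N - a N.+1).
  rewrite big_ord_recr /= sN -telescope [in RHS]big_ord_recr /=.
  rewrite add0r [_ * (_ + _)]mulrDr addrA [_ * y ^+ 2]mulrC; congr (_ + _).
  by rewrite !mulr_sumr -!big_split /=; apply: eq_bigr => j _; ring.
have d_decr : \sum_(j < N) (a (N - j)%N - a (N - j)%N.+1) * s j.+1 ^+ 2 <=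
    \sum_(j < N) (a (N - j)%N.-1 - a (N - j)%N) * s j.+1 ^+ 2.
  apply: ler_sum => j _; apply: ler_wpM2r; first exact: sqr_ge0.
  by have := ltn_ord j; rewrite -subn_gt0; case: (N - j)%N => //= m _; exact: a_convex.
have := ler_wpM2r (sqr_ge0 (s 0%N)) (a_decr N).
set A := \sum_(j < N) _ * s _; move: d_decr; set B := \sum_(j < N) _; set C := \sum_(j < N) _.
by move=> *; rewrite -/y; lra.
Qed.

(** Discrete form of the positivity of kernels that are nonnegative,
nonincreasing and convex: the form dominates a telescoping sum of
[kernel_energy]. *)
Lemma convex_kernel_ge0 (x : nat -> R) (N : nat) :
  0 <= \sum_(n < N) x n * (a 0%N / 2 * x n + \sum_(k < n) a (n - k)%N * x k).
Proof.
case: N => [|N]; first by rewrite big_ord0.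
rewrite -(pmulr_rge0 _ (ltr0n R 2)).
apply: le_trans (kernel_energy_ge0 x N) _.
elim: N => [|N IH]; last first.
  rewrite big_ord_recr /= mulrDr; apply: le_trans (kernel_energy_step x N) _.
  by rewrite lerD2r.
rewrite /kernel_energy big_nat1 big_ord_recr !big_ord0 /=.
by lra.
Qed.

End convex_kernel.

(** * Convexity of the fractional weights *)

(** Increments of [x ^ beta] between consecutive half-integers. The entry at [0]
is the increment across [0] of the odd extension of [x ^ beta]. It is twice the
leading weight of the scheme because twice a causal convolution form with kernel
[b] is the symmetric form with kernel [2 b_0, b_1, b_2, ...]. *)
Definition mid_incr {R : realType} (beta : R) (k : nat) : R :=
  if k is 0 then 2 * (1 / 2) `^ beta
  else (k%:R + 1 / 2) `^ beta - (k%:R - 1 / 2) `^ beta.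

(** By the inequality of means, [u + v >= 2 sqrt (u v)], and
[(x + 1) (x - 1) <= x ^ 2]. *)
Lemma powR_mid_convex (R : realType) (x t : R) : 1 < x -> t <= 0 ->
  2 * x `^ t <= (x + 1) `^ t + (x - 1) `^ t.
Proof.
move=> x1 t0.
have x0 : 0 < x by lra.
have xp : 0 < x + 1 by lra.
have xm : 0 < x - 1 by lra.
have prod_ge : x `^ t * x `^ t <= (x + 1) `^ t * (x - 1) `^ t.
  rewrite -!powRM; do ?exact: ltW.
  rewrite -[t]opprK !(powRN _ (- t)) lef_pV2 ?posrE ?powR_gt0 ?mulr_gt0 //.
  by apply: ge0_ler_powR; rewrite ?oppr_ge0 ?nnegrE //; nra.
have := powR_ge0 x t; have := powR_ge0 (x + 1) t; have := powR_ge0 (x - 1) t.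
move: prod_ge; set p := x `^ t; set u := (x + 1) `^ t; set v := (x - 1) `^ t.
move=> puv v0 u0 p0.
rewrite -(@ler_pXn2r _ 2) ?nnegrE ?addr_ge0 ?mulr_ge0 //.
have := sqr_ge0 (u - v); nra.
Qed.

Lemma is_derive_powR_shift (R : realType) (beta s x : R) : 0 < x + s ->
  is_derive x (1 : R) (fun y => (y + s) `^ beta) (beta * (x + s) `^ (beta - 1)).
Proof.
move=> xs.
have d1 : is_derive x (1 : R) (fun y : R => y + s) 1.
  by rewrite -[X in is_derive _ _ _ X]addr0; apply: is_deriveD.
have := @is_derive1_comp R (fun u => u `^ beta) (fun y : R => y + s) x _ _ (is_derive1_powR beta xs) d1.
by rewrite mulr1.
Qed.

(** The second difference [G] of [x ^ beta] has as its derivative [beta] times the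
second difference of the convex function [x ^ (beta - 1)], hence it is
nondecreasing. *)
Lemma third_difference_ge0 (R : realType) (beta x : R) : 0 < beta -> beta < 1 -> 0 < x ->
  0 <= (x + 3) `^ beta - 3 * (x + 2) `^ beta + 3 * (x + 1) `^ beta - x `^ beta.
Proof.
move=> beta_gt0 beta_lt1 x0.
pose G y : R := (y + 2) `^ beta - 2 * (y + 1) `^ beta + (y + 0) `^ beta.
pose dG y : R := beta * (y + 2) `^ (beta - 1)
  - 2 * (beta * (y + 1) `^ (beta - 1)) + beta * (y + 0) `^ (beta - 1).
have GE (y : R) : 0 < y -> is_derive y (1 : R) G (dG y).
  move=> y0.
  apply: is_deriveD; last by apply: is_derive_powR_shift; lra.
  apply: is_deriveB; first by apply: is_derive_powR_shift; lra.
  by apply: is_deriveZ; apply: is_derive_powR_shift; lra.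
have : G x <= G (x + 1).
  apply: (@ger0_derive1_ndecr _ G x (x + 1)) => //; last by lra.
  - by move=> y; rewrite in_itv /= => /andP[xy _]; have [] := GE y ltac:(lra).
  - move=> y; rewrite in_itv derive1E /= => /andP[xy _]; have y0 : 0 < y by lra.
    have [_ ->] := GE y y0.
    have y1 : 1 < y + 1 by lra.
    have b1 : beta - 1 <= 0 by rewrite subr_le0 ltW.
    have := powR_mid_convex _ _ _ y1 b1.
    rewrite /dG addrK addr0 -addrA (_ : 1 + 1 = 2) //.
    by rewrite -(ler_pM2l beta_gt0); lra.
  - apply: derivable_within_continuous => y; rewrite in_itv /= => /andP[xy _].
    by have [] := GE y ltac:(lra).
rewrite /G !addr0 -!addrA (_ : 1 + 2 = 3) // (_ : 1 + 1 = 2) //; lra.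
Qed.

Lemma second_difference_le0 (R : realType) (beta x : R) : 0 < beta -> beta < 1 -> 0 < x ->
  (x + 2) `^ beta - (x + 1) `^ beta <= (x + 1) `^ beta - x `^ beta.
Proof.
move=> beta_gt0 beta_lt1 x0.
pose G y : R := (y + 0) `^ beta - (y + 1) `^ beta.
pose dG y : R := beta * (y + 0) `^ (beta - 1) - beta * (y + 1) `^ (beta - 1).
have GE (y : R) : 0 < y -> is_derive y (1 : R) G (dG y).
  by move=> y0; apply: is_deriveB; apply: is_derive_powR_shift; lra.
have : G x <= G (x + 1).
  apply: (@ger0_derive1_ndecr _ G x (x + 1)) => //; last by lra.
  - by move=> y; rewrite in_itv /= => /andP[xy _]; have [] := GE y ltac:(lra).
  - move=> y; rewrite in_itv derive1E /= => /andP[xy _]; have y0 : 0 < y by lra.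
    have [_ ->] := GE y y0.
    rewrite /dG -mulrBr; apply: mulr_ge0; first exact: ltW.
    rewrite subr_ge0 addr0 -opprB !powRN.
    have b1 : 0 <= 1 - beta by rewrite subr_ge0 ltW.
    rewrite lef_pV2 ?posrE; try by apply: powR_gt0; lra.
    by apply: ge0_ler_powR; rewrite ?nnegrE //; lra.
  - apply: derivable_within_continuous => y; rewrite in_itv /= => /andP[xy _].
    by have [] := GE y ltac:(lra).
rewrite /G !addr0 -!addrA (_ : 1 + 1 = 2) //; lra.
Qed.

Lemma mid_incr_ge0 (R : realType) (beta : R) k : 0 < beta -> 0 <= mid_incr beta k.
Proof.
move=> beta_gt0; case: k => [|k] /=; first by rewrite mulr_ge0 ?powR_ge0.
have := ler0n R k; rewrite -natr1 subr_ge0 => k0.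
by apply: ge0_ler_powR; rewrite ?nnegrE; first [exact: ltW|lra].
Qed.

Lemma mid_incr_decr (R : realType) (beta : R) k : 0 < beta -> beta < 1 ->
  mid_incr beta k.+1 <= mid_incr beta k.
Proof.
move=> beta_gt0 beta_lt1; case: k => [|k] /=.
  have -> : 1 + 1 / 2 = 3 * (1 / 2) :> R by lra.
  have -> : 1 - 1 / 2 = 1 / 2 :> R by lra.
  have half_ge0 : 0 <= 1 / 2 :> R by rewrite divr_ge0 ?ler0n.
  rewrite powRM ?ler0n //.
  have h3 : (3 : R) `^ beta <= 3 by apply: ler1_powR; [rewrite ler1n|exact: ltW].
  have := powR_ge0 (1 / 2 : R) beta; nra.
have := second_difference_le0 _ beta (k.+1%:R - 1 / 2) beta_gt0 beta_lt1.
rewrite -[k.+2%:R]natr1.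
have := ler0n R k; rewrite -natr1 => k0.
rewrite (_ : k%:R + 1 - 1 / 2 + 2 = k%:R + 1 + 1 + 1 / 2); last by lra.
rewrite (_ : k%:R + 1 - 1 / 2 + 1 = k%:R + 1 + 1 / 2); last by lra.
rewrite (_ : k%:R + 1 + 1 - 1 / 2 = k%:R + 1 + 1 / 2); last by lra.
by apply; lra.
Qed.

Lemma powR_exprn (R : realType) (c t : R) (n : nat) : 0 <= c ->
  (c `^ t) ^+ n = (c ^+ n) `^ t.
Proof. by move=> c0; rewrite -powR_mulrn ?powR_ge0 // powRAC powR_mulrn. Qed.

(** For [k = 0] the claim is [3 * 3 ^ beta <= 4 + 5 ^ beta]. With
[y = 3 ^ ((beta - 1) / 2) <= 1] one has [3 ^ beta = 3 y^2], while [5^2 <= 3^3]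
and the negative exponent give [5 ^ beta >= 5 y^3]; and
[4 - 9 y^2 + 5 y^3 = (1 - y) (4 + 4 y - 5 y^2)]. For [k > 0] the claim is a
third difference of [x ^ beta] at positive points being nonnegative. *)
Lemma mid_incr_convex (R : realType) (beta : R) k : 0 < beta -> beta < 1 ->
  mid_incr beta k.+1 - mid_incr beta k.+2 <= mid_incr beta k - mid_incr beta k.+1.
Proof.
move=> beta_gt0 beta_lt1; case: k => [|k] /=.
  have -> : 1 + 1 / 2 = 3 * (1 / 2) :> R by lra.
  have -> : 2 + 1 / 2 = 5 * (1 / 2) :> R by lra.
  have -> : 2 - 1 / 2 = 3 * (1 / 2) :> R by lra.
  have -> : 1 - 1 / 2 = 1 / 2 :> R by lra.
  have half_ge0 : 0 <= 1 / 2 :> R by rewrite divr_ge0 ?ler0n.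
  rewrite (powRM _ (ler0n R 3)) // (powRM _ (ler0n R 5)) //.
  pose t : R := (1 - beta) / 2; pose y : R := (3 `^ t)^-1.
  have t0 : 0 < t by rewrite /t; lra.
  have pow_ge1 : 1 <= (3 : R) `^ t.
    by rewrite -[leLHS](powRr0 (3 : R)); apply: ler_powR; [rewrite ler1n|exact: ltW].
  have y_gt0 : 0 < y by rewrite invr_gt0 powR_gt0.
  have y_le1 : y <= 1 by rewrite invf_le1 // (lt_le_trans _ pow_ge1).
  have pow3 : (3 : R) `^ beta = 3 * y ^+ 2.
    rewrite /y -powRN -powR_mulrn ?powR_ge0 // -powRrM.
    rewrite -[X in X * _](powRr1 (ler0n R 3)) -powRD ?pnatr_eq0 ?implybT //.
    by congr (_ `^ _); rewrite /t; lra.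
  have pow5 : 5 * y ^+ 3 <= (5 : R) `^ beta.
    rewrite -(mulr_powRB1 (ler0n R 5) beta_gt0) ler_pM2l //.
    have -> : beta - 1 = 2%:R * (- t) by rewrite /t; lra.
    rewrite powRrM powR_mulrn // powRN /y exprVn lef_pV2 ?posrE ?exprn_gt0 ?powR_gt0 //.
    rewrite powR_exprn ?ler0n //.
    by apply: ge0_ler_powR; rewrite ?nnegrE ?exprn_ge0 ?ler0n ?(ltW t0) //; lra.
  have := powR_ge0 (1 / 2 : R) beta; set h := _ `^ beta => h0.
  have key : 0 <= 4 - 9 * y ^+ 2 + 5 * y ^+ 3.
    rewrite (_ : _ + _ = (1 - y) * (4 + 4 * y - 5 * y ^+ 2)); last by ring.
    by apply: mulr_ge0; nra.
  rewrite pow3; move: pow5; set q := _ `^ beta; move: key; nra.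
have := third_difference_ge0 _ beta (k.+1%:R - 1 / 2) beta_gt0 beta_lt1.
rewrite -[k.+3%:R]natr1 -[k.+2%:R]natr1.
have := ler0n R k; rewrite -natr1 => k0.
rewrite (_ : k%:R + 1 - 1 / 2 + 3 = k%:R + 1 + 1 + 1 + 1 / 2); last by lra.
rewrite (_ : k%:R + 1 - 1 / 2 + 2 = k%:R + 1 + 1 + 1 / 2); last by lra.
rewrite (_ : k%:R + 1 - 1 / 2 + 1 = k%:R + 1 + 1 / 2); last by lra.
rewrite (_ : k%:R + 1 + 1 + 1 - 1 / 2 = k%:R + 1 + 1 + 1 / 2); last by lra.
rewrite (_ : k%:R + 1 + 1 - 1 / 2 = k%:R + 1 + 1 / 2); last by lra.
by move=> /(_ ltac:(lra)); lra.
Qed.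

(** Up to the common factor [tau ^ (1 - alpha) / Gamma (2 - alpha)], the weights
are the entries of [mid_incr (1 - alpha)], the first one halved. *)
Lemma btilde_form_ge0 (R : realType) (alpha tau : R) (x : nat -> R) (N : nat) :
  0 < alpha < 1 ->
  0 <= \sum_(n < N) x n * \sum_(k < n.+1) btilde alpha tau (n - k) * x k.
Proof.
case/andP=> alpha_gt0 alpha_lt1.
have beta_gt0 : 0 < 1 - alpha by rewrite subr_gt0.
have beta_lt1 : 1 - alpha < 1 by rewrite ltrBlDr ltrDl.
set beta := 1 - alpha in beta_gt0 beta_lt1 *.
pose c := tau `^ beta / Gamma (2 - alpha).
have c_ge0 : 0 <= c.
  rewrite divr_ge0 ?powR_ge0 // Rintegral_ge0 // => t _.
  by rewrite mulr_ge0 ?powR_ge0 ?expR_ge0.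
have btilde0 : btilde alpha tau 0 = c * (mid_incr beta 0 / 2).
  rewrite /btilde /mid_incr /c -/beta [2 * _]mulrC mulfK ?pnatr_eq0 //.
  rewrite powRM ?invr_ge0 ?ler0n // powR1 mul1r -(powR_inv1 (ler0n R 2)).
  by rewrite powRAC powR_inv1 ?powR_ge0 // invfM mulrA.
have btildeS k : btilde alpha tau k.+1 = c * mid_incr beta k.+1 by [].
have := convex_kernel_ge0 _ (fun k => mid_incr_ge0 _ beta k beta_gt0)
  (fun k => mid_incr_decr _ beta k beta_gt0 beta_lt1)
  (fun k => mid_incr_convex _ beta k beta_gt0 beta_lt1) x N.
move/(mulr_ge0 c_ge0); rewrite mulr_sumr; congr (0 <= _).
apply: eq_bigr => n _; rewrite mulrCA; congr (_ * _).
rewrite big_ord_recr /= subnn btilde0 [LHS]mulrDr [LHS]addrC; congr (_ + _); last exact: mulrA.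
rewrite mulr_sumr; apply: eq_bigr => k _.
have := ltn_ord k; rewrite -subn_gt0; case: (n - k)%N => // m _.
by rewrite btildeS mulrA.
Qed.

Set Implicit Arguments.
Unset Strict Implicit.

(** * The inner product of L2(Omega) *)

Section L2.
Context {R : realType} {d : nat} (Omega : set 'rV[R]_d).
Hypothesis mOmega : measurable Omega.
Implicit Types (u v w : 'rV[R]_d -> R) (a b : R).
Local Notation mu := (lebesgue_rV R d).
Local Notation L2 := (in_L2 Omega).

Definition dot u v : R := \int[mu]_(x in Omega) (u x * v x).

Lemma integrable_mul u v : L2 u -> L2 v ->
  mu.-integrable Omega (EFin \o (fun x => u x * v x)).
Proof.
move=> [mu_ iu] [mv iv].
apply: (@le_integrable _ _ _ _ _ mOmega _ (EFin \o (fun x => u x ^+ 2 + v x ^+ 2))).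
- by apply/measurable_EFinP; exact: measurable_funM.
- move=> x _ /=; rewrite lee_fin [leRHS]ger0_norm ?addr_ge0 ?sqr_ge0 //.
  rewrite ler_norml; apply/andP; split.
    by have := sqr_ge0 (u x + v x); have := sqr_ge0 (u x); have := sqr_ge0 (v x); rewrite sqrrD; lra.
  by have := sqr_ge0 (u x - v x); have := sqr_ge0 (u x); have := sqr_ge0 (v x); rewrite sqrrB; lra.
- exact: (integrableD mOmega iu iv).
Qed.

Lemma in_L2_lin a b u v : L2 u -> L2 v -> L2 (fun x => a * u x + b * v x).
Proof.
move=> Lu Lv; have [mu_ iu] := Lu; have [mv iv] := Lv; split.
  by apply: measurable_funD; apply: measurable_funM.
have -> : (fun x => ((a * u x + b * v x) ^+ 2)%:E) = (fun x =>
    (a ^+ 2)%R%:E * (u x ^+ 2)%R%:E + ((2 * a * b)%R%:E * (u x * v x)%R%:E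
    + (b ^+ 2)%R%:E * (v x ^+ 2)%R%:E))%E.
  by apply/funext => x /=; rewrite -!EFinM -!EFinD; congr EFin; ring.
by apply: integrableD => //; [|apply: integrableD => //];
  apply: integrableZl => //; exact: integrable_mul.
Qed.

Lemma dotC u v : dot u v = dot v u.
Proof. by apply: eq_Rintegral => x _; rewrite mulrC. Qed.

Lemma dot_ge0 u : 0 <= dot u u.
Proof. by apply: Rintegral_ge0 => x _; rewrite -expr2 sqr_ge0. Qed.

Lemma dot_linl a b u v w : L2 u -> L2 v -> L2 w ->
  dot (fun x => a * u x + b * v x) w = a * dot u w + b * dot v w.
Proof.
move=> Lu Lv Lw; have iu := integrable_mul Lu Lw; have iv := integrable_mul Lv Lw.
rewrite -!RintegralZl // -RintegralD //.
- by apply: eq_Rintegral => x _; ring.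
- exact: (integrableZl mOmega a iu).
- exact: (integrableZl mOmega b iv).
Qed.

Lemma dot_linr a b u v w : L2 u -> L2 v -> L2 w ->
  dot w (fun x => a * u x + b * v x) = a * dot w u + b * dot w v.
Proof. by move=> Lu Lv Lw; rewrite dotC dot_linl // !(dotC w). Qed.

Lemma in_L2_ext u v : u =1 v -> L2 u -> L2 v.
Proof. by move=> /funext ->. Qed.

Lemma in_L20 : L2 (fun=> 0).
Proof.
split; first exact: measurable_cst.
rewrite (_ : (fun=> _) = cst 0%E); first exact: integrable0.
by apply/funext => x; rewrite expr2 mul0r.
Qed.

Lemma in_L2_sum I (s : seq I) (P : pred I) (u : I -> 'rV[R]_d -> R) :
  (forall i, P i -> L2 (u i)) -> L2 (fun x => \sum_(i <- s | P i) u i x).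
Proof.
move=> Lu; elim: s => [|i s IH].
  by apply: in_L2_ext in_L20 => x; rewrite big_nil.
have [Pi|nPi] := boolP (P i).
  by apply: in_L2_ext (in_L2_lin 1 1 (Lu i Pi) IH) => x; rewrite big_cons Pi !mul1r.
by apply: in_L2_ext IH => x; rewrite big_cons (negbTE nPi).
Qed.

Lemma dot_suml I (s : seq I) (P : pred I) (u : I -> 'rV[R]_d -> R) w :
  (forall i, P i -> L2 (u i)) -> L2 w ->
  dot (fun x => \sum_(i <- s | P i) u i x) w = \sum_(i <- s | P i) dot (u i) w.
Proof.
move=> Lu Lw; elim: s => [|i s IH].
  have -> : (fun x => \sum_(i <- [::] | P i) u i x) = (fun x => 0 * w x + 0 * w x).
    by apply/funext => x; rewrite big_nil !mul0r addr0.
  by rewrite dot_linl // !mul0r addr0 big_nil.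
rewrite big_cons; have Ls := @in_L2_sum _ s P u Lu.
case: ifPn => Pi; last first.
  by rewrite -IH; apply: eq_Rintegral => x _; rewrite big_cons (negbTE Pi).
rewrite -IH -[X in X + _]mul1r -[X in _ + X]mul1r -dot_linl //; last exact: Lu.
by apply: eq_Rintegral => x _; rewrite big_cons Pi !mul1r.
Qed.

Lemma dot_cauchy_schwarz u v : L2 u -> L2 v -> dot u v ^+ 2 <= dot u u * dot v v.
Proof.
move=> Lu Lv.
have quad a b : 0 <= a ^+ 2 * dot u u + 2 * a * b * dot u v + b ^+ 2 * dot v v.
  have Lw := in_L2_lin a b Lu Lv; have := dot_ge0 (fun x => a * u x + b * v x).
  by rewrite dot_linl // !dot_linr // (dotC v u); lra.
have [v0|vn0] := eqVneq (dot v v) 0.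
  have := quad (- dot u v) (dot u u + 1).
  have := dot_ge0 u; rewrite v0; set p := dot u u; set q := dot u v; nra.
have v_gt0 : 0 < dot v v by rewrite lt_neqAle eq_sym vn0 dot_ge0.
rewrite -subr_ge0 -(pmulr_rge0 _ v_gt0).
have := quad (dot v v) (- dot u v); congr (0 <= _); ring.
Qed.

Lemma dot_cvg (f g : nat -> 'rV[R]_d -> R) u v :
  (forall k, L2 (f k)) -> (forall k, L2 (g k)) -> L2 u -> L2 v ->
  L2_norm_sq Omega (fun x => f k x - u x) @[k --> \oo] --> (0 : R) ->
  L2_norm_sq Omega (fun x => g k x - v x) @[k --> \oo] --> (0 : R) ->
  dot (f k) (g k) @[k --> \oo] --> dot u v.
Proof.
move=> Lf Lg Lu Lv fu gv.
pose df k x := f k x - u x; pose dg k x := g k x - v x.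
have L2B (p q : 'rV[R]_d -> R) : L2 p -> L2 q -> L2 (fun x => p x - q x).
  by move=> Lp Lq; apply: in_L2_ext (in_L2_lin 1 (- 1) Lp Lq) => x; rewrite mul1r mulN1r.
have Ldf k : L2 (df k) by exact: L2B.
have Ldg k : L2 (dg k) by exact: L2B.
have normE w : L2_norm_sq Omega w = dot w w.
  by apply: eq_Rintegral => x _; rewrite expr2.
have null (p q : nat -> 'rV[R]_d -> R) : (forall k, L2 (p k)) -> (forall k, L2 (q k)) ->
    dot (p k) (p k) * dot (q k) (q k) @[k --> \oo] --> (0 : R) ->
    dot (p k) (q k) @[k --> \oo] --> (0 : R).
  move=> Lp Lq pq0; apply/norm_cvg0P.
  have sq0 : Num.sqrt (dot (p k) (p k) * dot (q k) (q k)) @[k --> \oo] --> (0 : R).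
    rewrite -[X in _ --> X]sqrtr0.
    by apply: (@cvg_comp _ _ _ _ Num.sqrt _ _ _ pq0); exact: sqrt_continuous.
  apply: (squeeze_cvgr _ (cvg_cst 0) sq0).
  by near=> k; rewrite normr_ge0 -sqrtr_sqr ler_wsqrtr // dot_cauchy_schwarz.
have df0 : dot (df k) (df k) @[k --> \oo] --> (0 : R).
  by under eq_cvg do rewrite -normE.
have dg0 : dot (dg k) (dg k) @[k --> \oo] --> (0 : R).
  by under eq_cvg do rewrite -normE.
have -> : (fun k => dot (f k) (g k)) = (fun k => dot (df k) (dg k) +
    (dot (df k) v + dot u (dg k)) + dot u v).
  apply/funext => k.
  have -> : f k = (fun x => 1 * df k x + 1 * u x) by apply/funext => x; rewrite /df; ring.
  have -> : g k = (fun x => 1 * dg k x + 1 * v x) by apply/funext => x; rewrite /dg; ring.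
  rewrite dot_linl //; last exact: in_L2_lin.
  rewrite !dot_linr //; ring.
rewrite -[X in _ --> X]add0r -[X in _ --> X + _]addr0 -[X in _ --> _ + X + _]addr0.
apply: cvgD; last exact: cvg_cst.
apply: cvgD; [|apply: cvgD].
- by apply: null => //; rewrite -[X in _ --> X](mulr0 0); exact: cvgM.
- apply: (null _ (fun=> v)) => //.
  by rewrite -[X in _ --> X](mul0r (dot v v)); apply: cvgM => //; exact: cvg_cst.
- apply: (null (fun=> u)) => //.
  by rewrite -[X in _ --> X](mulr0 (dot u u)); apply: cvgM => //; exact: cvg_cst.
Unshelve. all: by end_near. Qed.

End L2.

(** * Lebesgue measure on row vectors and continuous functions *)

Section euclidean_measure.
Context {R : realType}.

Lemma measurable_open_box d (a b : 'rV[R]_d) : measurable (open_box a b).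
Proof.
have -> : open_box a b =
    \bigcap_(i in [set: 'I_d]) (rV_coord i @^-1` `]a ord0 i, b ord0 i[%classic).
  apply/seteqP; split=> x /= xab i.
    by move=> _; rewrite /= in_itv /=; exact: xab.
  by have := xab i I; rewrite /= in_itv.
apply: fin_bigcap_measurable => [|i _]; first exact: finite_finset.
by rewrite -[X in measurable X]setTI; exact: measurable_rV_coord.
Qed.

(** The sigma-algebra is defined from the coordinates, not from the topology:
an open set is measurable because it is the union of the countably many boxes
with rational corners that it contains. *)
Lemma open_measurable_rV d (A : set 'rV[R]_d) : open A -> measurable A.
Proof.
move=> oA.
pose rbox (q : {ffun 'I_d -> rat * rat}) : set 'rV[R]_d :=
  open_box (\row_i ratr (q i).1) (\row_i ratr (q i).2).
have -> : A = \bigcup_q (if `[< rbox q `<=` A >] then rbox q else set0).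
  apply/seteqP; split=> [x Ax|x [q _]]; last by case: asboolP => // qA /qA.
  have /nbhs_ballP[e /= e0 xeA] : nbhs x A by exact: open_nbhs_nbhs.
  have /choice[q qP] : forall i : 'I_d, exists q : rat * rat,
      [/\ x ord0 i - e < ratr q.1, ratr q.1 < x ord0 i,
          x ord0 i < ratr q.2 & ratr q.2 < x ord0 i + e].
    move=> i.
    have [p] := @rat_in_itvoo R (x ord0 i - e) (x ord0 i) ltac:(by rewrite ltrBlDr ltrDl).
    rewrite in_itv /= => /andP[p1 p2].
    have [s] := @rat_in_itvoo R (x ord0 i) (x ord0 i + e) ltac:(by rewrite ltrDl).
    by rewrite in_itv /= => /andP[s1 s2]; exists (p, s).
  exists [ffun i => q i] => //; case: asboolP => [_|]; last first.
    case=> y yq; apply: xeA; split=> // i j; rewrite (ord1 i).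
    have := yq j; rewrite !mxE !ffunE => /andP[y1 y2]; have [q1 q2 q3 q4] := qP j.
    by rewrite /ball /= ltr_norml; apply/andP; split; lra.
  by move=> i; rewrite !mxE !ffunE; have [_ -> -> _] := qP i.
apply: countable_bigcupT_measurable => [|q]; first exact: countableP.
by case: asboolP => _; [exact: measurable_open_box|exact: measurable0].
Qed.

Lemma open_box_finite d (a b : 'rV[R]_d) : (lebesgue_rV R d (open_box a b) < +oo)%E.
Proof.
elim: d a b => [|d IH] a b.
  by rewrite /= diracE ltry.
rewrite /= /lebesgue_step /pushforward.
have -> : @rV_cons R d @^-1` open_box a b =
    `]a ord0 ord0, b ord0 ord0[%classic `*` open_box (@rsubmx R 1 1 d a) (@rsubmx R 1 1 d b).
  apply/seteqP; split=> -[t y] /=.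
    move=> ab; split.
    - have := ab ord0; rewrite /rV_cons in_itv /=.
      rewrite (_ : (ord0 : 'I_d.+1) = lshift d (ord0 : 'I_1)); last exact: val_inj.
      by rewrite (@row_mxEl R 1 1 d) mxE.
    - by move=> j; have := ab (rshift 1 j); rewrite /rV_cons (@row_mxEr R 1 1 d) !mxE.
  rewrite in_itv /= => -[t_ab y_ab] i; rewrite /rV_cons.
  case: (@split_ordP 1 d i) => j ->.
    rewrite (@row_mxEl R 1 1 d) mxE /= (ord1 j).
    by rewrite (_ : lshift d (ord0 : 'I_1) = (ord0 : 'I_d.+1)) //; exact: val_inj.
  by rewrite (@row_mxEr R 1 1 d); have := y_ab j; rewrite !mxE.
rewrite product_measure1E //; last exact: measurable_open_box.
rewrite lte_mul_pinfty ?IH //.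
(* Restores the plain form of the measure, hidden by a structure coercion. *)
have -> : lebesgue_measure_lebesgue_measure__canonical__measure_function_Measure R
    `]a ord0 ord0, b ord0 ord0[%classic =
    @lebesgue_measure R `]a ord0 ord0, b ord0 ord0[%classic by [].
by rewrite lebesgue_measure_itv /=; case: ifP => _; rewrite -?EFinD ?ltry ?fin_numE.
Qed.

Lemma bounded_sub_box d (A : set 'rV[R]_d) : bounded_set A ->
  exists r : R, A `<=` open_box (const_mx (- r)) (const_mx r).
Proof.
move=> [M [_ AM]]; pose r : R := `|M| + 2; exists r => x Ax i.
have [_ xr] : ball (0 : 'rV[R]_d) r x.
  rewrite -ball_normE /ball_ /= sub0r normrN.
  apply: (@le_lt_trans _ _ (`|M| + 1)); last by rewrite /r; lra.
  by apply: AM => //; have := ler_norm M; lra.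
have := xr ord0 i; rewrite /ball /= !mxE sub0r normrN ltr_norml.
by move=> /andP[-> ->].
Qed.

Lemma bounded_finite d (A : set 'rV[R]_d) : measurable A -> bounded_set A ->
  (lebesgue_rV R d A < +oo)%E.
Proof.
move=> mA /bounded_sub_box[r Ar].
apply: le_lt_trans (open_box_finite (const_mx (- r)) (const_mx r)).
by apply: le_measure => //; rewrite inE //; exact: measurable_open_box.
Qed.

Lemma continuous_measurable_rV d (f : 'rV[R]_d -> R) : continuous f ->
  measurable_fun [set: 'rV[R]_d] f.
Proof.
move=> /continuousP cf; apply: (measurability _ (RGenOpens.measurableE R)).
move=> _ [_ [a [b ->]] <-]; rewrite setTI; apply: open_measurable_rV.
by apply: cf; exact: interval_open.
Qed.

Lemma continuous_bounded_integrable d (A : set 'rV[R]_d) (f : 'rV[R]_d -> R) :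
  measurable A -> bounded_set A -> continuous f ->
  (lebesgue_rV R d).-integrable A (EFin \o f).
Proof.
move=> mA bA cf; apply: measurable_bounded_integrable => //.
- exact: bounded_finite.
- by apply: measurable_funTS; exact: continuous_measurable_rV.
have [r Ar] := bounded_sub_box bA.
pose K : set 'rV[R]_d := [set v | forall i, `[- r, r]%classic (v ord0 i)].
have cK : compact K by apply: (@rV_compact _ _ (fun=> `[- r, r]%classic)) => _; exact: segment_compact.
have bfK : bounded_set (f @` K).
  apply: compact_bounded; apply: continuous_compact => //.
  exact: continuous_subspaceT.
have [M [Mr fM]] := bfK.
exists M; split=> // x Mx y Ay; apply: fM => //; exists y => // i.
by have := Ar y Ay i; rewrite !mxE /= in_itv /= => /andP[/ltW -> /ltW ->].
Qed.

Lemma continuous_in_L2 d (A : set 'rV[R]_d) (f : 'rV[R]_d -> R) :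
  measurable A -> bounded_set A -> continuous f -> in_L2 A f.
Proof.
move=> mA bA cf; split; first by apply: measurable_funTS; exact: continuous_measurable_rV.
apply: (continuous_bounded_integrable (f := fun x => f x ^+ 2)) => // x.
by apply: (@continuous_comp _ _ _ f (fun y => y ^+ 2)); [exact: cf|exact: exprn_continuous].
Qed.

End euclidean_measure.

(** * Integration by parts for periodic functions *)

Section lines.
Context {R : realType}.

Definition on_line d (i : 'I_d) (x : 'rV[R]_d) (t : R) : 'rV[R]_d :=
  x + (t - x ord0 i) *: basis_vector R i.

Lemma on_lineE d (i j : 'I_d) (x : 'rV[R]_d) (t : R) :
  on_line i x t ord0 j = if j == i then t else x ord0 j.
Proof.
rewrite !mxE eqxx /= eq_sym; have [->|_] := eqVneq i j; last by rewrite mulr0 addr0.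
by rewrite mulr1 addrC subrK.
Qed.

Lemma rV_cons0 d (t : R) (y : 'rV[R]_d) : rV_cons (t, y) ord0 ord0 = t.
Proof.
rewrite /rV_cons /= (_ : ord0 = lshift d (ord0 : 'I_1) :> 'I_d.+1); last exact: val_inj.
by rewrite (@row_mxEl R 1 1 d) mxE.
Qed.

Lemma rV_consS d (t : R) (y : 'rV[R]_d) (j : 'I_d) :
  rV_cons (t, y) ord0 (rshift 1 j) = y ord0 j.
Proof. by rewrite /rV_cons (@row_mxEr R 1 1 d). Qed.

Lemma rV_cons_line0 d (t s : R) (y : 'rV[R]_d) :
  on_line ord0 (rV_cons (s, y)) t = rV_cons (t, y).
Proof.
apply/rowP => k; rewrite on_lineE; case: (@split_ordP 1 d k) => j ->.
  rewrite (ord1 j) (_ : lshift d (ord0 : 'I_1) = ord0 :> 'I_d.+1); last exact: val_inj.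
  by rewrite eqxx rV_cons0.
by rewrite !rV_consS -val_eqE.
Qed.

Lemma rV_cons_lineS d (j : 'I_d) (t s : R) (y : 'rV[R]_d) :
  on_line (rshift 1 j) (rV_cons (s, y)) t = rV_cons (s, on_line j y t).
Proof.
apply/rowP => k; rewrite on_lineE; case: (@split_ordP 1 d k) => l ->.
  rewrite (ord1 l) (_ : lshift d (ord0 : 'I_1) = ord0 :> 'I_d.+1); last exact: val_inj.
  by rewrite -val_eqE /= !rV_cons0.
by rewrite !rV_consS on_lineE (inj_eq (@rshift_inj 1 d)).
Qed.

(** Fubini, one coordinate at a time along the recursive definition of the
measure: when [i] is the first coordinate it is integrated innermost; otherwise
almost every slice with the first coordinate fixed is integrable, and the
induction hypothesis applies to it. *)
Lemma integral_lines0 d (i : 'I_d) (h : 'rV[R]_d -> R) :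
  (lebesgue_rV R d).-integrable setT (EFin \o h) ->
  (forall x, \int[@lebesgue_measure R]_t (h (on_line i x t))%:E = 0)%E ->
  (\int[lebesgue_rV R d]_x (h x)%:E = 0)%E.
Proof.
elim: d i h => [[]//|d IH] i h ih hline.
have [mh hoo] := integrableP _ _ _ ih.
pose m := (@lebesgue_measure R \x lebesgue_rV R d)%E.
pose f := EFin \o (h \o @rV_cons R d).
have mf : measurable_fun setT f.
  exact: (measurableT_comp mh (@measurable_rV_cons R d)).
have ihc : m.-integrable setT f.
  apply/integrableP; split=> //; move: hoo.
  rewrite /= /lebesgue_step (ge0_integral_pushforward (@measurable_rV_cons R d)) //.
  by apply/measurable_EFinP; apply: measurableT_comp => //; exact/measurable_EFinP.
rewrite /= /lebesgue_step.
rewrite (@integral_pushforward _ _ _ _ _ _ (@measurable_rV_cons R d) _ setT (EFin \o h) mh) //.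
rewrite preimage_setT -/f.
case: (@split_ordP 1 d i) hline => j -> hline.
- rewrite -(integral21_prod_meas1 ihc) /fubini_G.
  rewrite integral0_eq // => y _; rewrite -[RHS](hline (rV_cons (0, y))).
  apply: eq_integral => t _; rewrite /f /= (ord1 j).
  by rewrite (_ : lshift d (ord0 : 'I_1) = ord0 :> 'I_d.+1) ?rV_cons_line0 //; exact: val_inj.
- rewrite -(integral12_prod_meas1 ihc).
  rewrite -[RHS](integral0 (@lebesgue_measure R) setT).
  apply: ae_eq_integral => //; first exact: measurable_fubini_F ihc.
  have := ae_integrable1 ihc; apply: filterS => t it _.
  apply: (IH j (fun y => h (rV_cons (t, y)))) => // y.
  rewrite -[RHS](hline (rV_cons (t, y))).
  by apply: eq_integral => s _; rewrite rV_cons_lineS.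
Qed.

Lemma continuous_on_line d (i : 'I_d) (x : 'rV[R]_d) : continuous (on_line i x).
Proof.
move=> t; apply: (@cvgD _ _ _ _ _ (fun=> x)); first exact: cvg_cst.
apply: (@cvgZr_tmp _ _ _ _ _ (fun t => t - x ord0 i)).
by apply: cvgB; [exact: cvg_id|exact: cvg_cst].
Qed.

(** Both difference quotients are literally the same function of the step, so
directional derivatives are ordinary derivatives along a line. *)
Lemma line_quotient d (i : 'I_d) (f : 'rV[R]_d -> R) (x : 'rV[R]_d) (t : R) :
  (fun h : R => h^-1 *: (((f \o on_line i x) \o shift t) (h *: 1) - (f \o on_line i x) t)) =
  (fun h : R => h^-1 *: ((f \o shift (on_line i x t)) (h *: basis_vector R i) - f (on_line i x t))).
Proof.
apply/funext => h; congr (_ *: (f _ - _)).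
by rewrite /= /on_line addrCA -scalerDl addrA [h *: 1]mulr1.
Qed.

Lemma derivable_line d (i : 'I_d) (f : 'rV[R]_d -> R) (x : 'rV[R]_d) (t : R) :
  derivable f (on_line i x t) (basis_vector R i) -> derivable (f \o on_line i x) t 1.
Proof. by rewrite /derivable line_quotient. Qed.

Lemma derive_line d (i : 'I_d) (f : 'rV[R]_d -> R) (x : 'rV[R]_d) (t : R) :
  derive1 (f \o on_line i x) t = partial i f (on_line i x t).
Proof. by rewrite derive1E /derive line_quotient. Qed.

(** The line either misses the box or crosses it along a full period, and then
the fundamental theorem of calculus gives the difference of two equal values. *)
Lemma integral_partial_line d (i : 'I_d) (f : 'rV[R]_d -> R) (a b x : 'rV[R]_d) :
  a ord0 i < b ord0 i ->
  (forall y, derivable f y (basis_vector R i)) -> continuous (partial i f) ->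
  periodic_fun a b f ->
  (\int[@lebesgue_measure R]_t ((partial i f \_ (open_box a b)) (on_line i x t))%:E = 0)%E.
Proof.
move=> ab df cf pf.
have [x_ab|nx_ab] := pselect (forall j, j != i -> a ord0 j < x ord0 j < b ord0 j); last first.
  apply: integral0_eq => t _; rewrite patchE ifF //.
  apply/negP; rewrite inE => box; apply: nx_ab => j ji.
  by have := box j; rewrite on_lineE (negbTE ji).
have cg : continuous (partial i f \o on_line i x).
  by move=> t; apply: continuous_comp; [exact: continuous_on_line|exact: cf].
transitivity (\int[@lebesgue_measure R]_(t in `]a ord0 i, b ord0 i[)
    ((partial i f \o on_line i x) t)%:E)%E.
  rewrite [RHS]integral_mkcond; apply: eq_integral => t _.
  rewrite !patchE; have -> : (on_line i x t \in open_box a b) = (t \in `]a ord0 i, b ord0 i[%classic).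
    apply/idP/idP; rewrite !inE /= in_itv /=.
      by move=> /(_ i); rewrite on_lineE eqxx.
    by move=> tab j; rewrite on_lineE; case: eqVneq => [->//|]; exact: x_ab.
  by case: ifP.
rewrite -(@integral_itv_bndoo _ _ _ _ true false); last first.
  apply/measurable_EFinP; apply: measurable_funTS; exact: continuous_measurable_fun.
rewrite (@continuous_FTC2 _ _ (f \o on_line i x)) //.
- rewrite -EFinB; congr EFin; rewrite /=.
  rewrite -[X in _ - X](pf _ i); apply/eqP; rewrite subr_eq0; apply/eqP; congr f.
  by rewrite /on_line -addrA -scalerDl; congr (_ + _ *: _); ring.
- exact: continuous_subspaceT.
- have dg t : derivable (f \o on_line i x) t 1 by exact: derivable_line.
  have cgf t : {for t, continuous (f \o on_line i x)}.
    exact/differentiable_continuous/derivable1_diffP.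
  split=> [t _||]; first exact: dg.
  + exact/cvg_at_right_filter/cgf.
  + exact/cvg_at_left_filter/cgf.
- by move=> t _; rewrite derive_line.
Qed.

Lemma integral_partial_periodic d (i : 'I_d) (f : 'rV[R]_d -> R) (a b : 'rV[R]_d) :
  a ord0 i < b ord0 i -> bounded_set (open_box a b) ->
  (forall y, derivable f y (basis_vector R i)) -> continuous (partial i f) ->
  periodic_fun a b f ->
  \int[lebesgue_rV R d]_(x in open_box a b) partial i f x = 0.
Proof.
move=> ab bdd df cf pf; rewrite Rintegral_mkcond /Rintegral.
rewrite (@integral_lines0 _ i) // => [|x].
  rewrite -restrict_EFin; apply/(integrable_mkcond _ (measurable_open_box a b)).
  by apply: continuous_bounded_integrable => //; exact: measurable_open_box.
exact: integral_partial_line.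
Qed.

Lemma periodic_partial d (i : 'I_d) (f : 'rV[R]_d -> R) (a b : 'rV[R]_d) :
  periodic_fun a b f -> periodic_fun a b (partial i f).
Proof.
move=> pf x j; rewrite /partial /derive.
set y := x + _; pose q z (h : R) := h^-1 *: ((f \o shift z) (h *: basis_vector R i) - f z).
by rewrite -[X in lim (X @ _)]/(q y) (_ : q y = q x) //; apply/funext => h;
  rewrite /q /= addrA !pf.
Qed.

Lemma periodic_ibp d (i : 'I_d) (f g : 'rV[R]_d -> R) (a b : 'rV[R]_d) :
  a ord0 i < b ord0 i -> bounded_set (open_box a b) ->
  smooth f -> smooth g -> periodic_fun a b f -> periodic_fun a b g ->
  dot (open_box a b) (partial i f) g = - dot (open_box a b) f (partial i g).
Proof.
move=> ab bdd sf sg pf pg.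
have mbox := measurable_open_box a b.
have [cf dfs] := sf 1%N; have [cg dgs] := sg 1%N.
have [df cdf] := dfs i; have [dg cdg] := dgs i.
have Lc h (ch : continuous h) := continuous_in_L2 mbox bdd ch.
have pE : partial i (f * g) = (fun x => f x * partial i g x + partial i f x * g x).
  by apply/funext => x; rewrite /partial deriveM // [in RHS](mulrC _ (g x)).
have := @integral_partial_periodic d i (f * g) a b ab bdd.
rewrite pE RintegralD //; last 2 first.
- exact: (integrable_mul mbox (Lc _ cf) (Lc _ cdg)).
- exact: (integrable_mul mbox (Lc _ cdf) (Lc _ cg)).
move=> H; apply/eqP; rewrite -addr_eq0 addrC; apply/eqP; apply: H.
- by move=> y; exact: derivableM.
- by move=> x; exact: (cvgD (cvgM (cf x) (cdg x)) (cvgM (cdf x) (cg x))).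
- by move=> x j; rewrite /GRing.mul /= pf pg.
Qed.

End lines.

(** * Gradients and Green's identity *)

Section dot_fields.
Context {R : realType} {d : nat} (Omega : set 'rV[R]_d).
Hypothesis mOmega : measurable Omega.
Local Notation mu := (lebesgue_rV R d).
Local Notation L2 := (in_L2 Omega).

Lemma Rintegral_sum_mul (I : Type) (s : seq I) (f g : I -> 'rV[R]_d -> R) :
  (forall i, L2 (f i)) -> (forall i, L2 (g i)) ->
  mu.-integrable Omega (EFin \o (fun x => \sum_(i <- s) f i x * g i x)) /\
  \int[mu]_(x in Omega) (\sum_(i <- s) f i x * g i x) =
  \sum_(i <- s) dot Omega (f i) (g i).
Proof.
move=> Lf Lg; elim: s => [|i s [IHi IH]].
  have E : (fun x => \sum_(i <- [::]) f i x * g i x) = cst 0.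
    by apply/funext => x; rewrite big_nil.
  by rewrite E big_nil Rintegral_cst // mul0r; split=> //; exact: integrable0.
have E : (fun x => \sum_(j <- i :: s) f j x * g j x) =
    (fun x => f i x * g i x + \sum_(j <- s) f j x * g j x).
  by apply/funext => x; rewrite big_cons.
have ii := integrable_mul mOmega (Lf i) (Lg i).
rewrite E big_cons; split; first exact: (integrableD mOmega ii IHi).
by rewrite RintegralD // IH.
Qed.

Definition gram (w v : jet2 R d) : R := \sum_(i < d) dot Omega (grad w i) (grad v i).

Lemma in_H2_L2 (w : jet2 R d) : in_H2 Omega w ->
  [/\ L2 (fval w), forall i, L2 (grad w i), forall i j, L2 (hess w i j) & L2 (lap w)].
Proof.
move=> [[Lw gw] hw].
have Lh i j : L2 (hess w i j) by have [_ /(_ j)[]] := hw i.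
split=> // [i|]; first by have [] := gw i.
by apply: in_L2_sum => // i _; exact: Lh.
Qed.

Lemma gramC (w v : jet2 R d) : gram w v = gram v w.
Proof. by apply: eq_bigr => i _; rewrite dotC. Qed.

Lemma grad_norm_sqE (w : jet2 R d) : (forall i, L2 (grad w i)) ->
  grad_norm_sq Omega w = gram w w.
Proof.
move=> Lw; rewrite /gram; have [_ <-] := @Rintegral_sum_mul _ (index_enum 'I_d) (grad w) (grad w) Lw Lw.
by apply: eq_Rintegral => x _; apply: eq_bigr => i _; rewrite expr2.
Qed.

Lemma grad_norm_sq_sub (w v : jet2 R d) :
  (forall i, L2 (grad w i)) -> (forall i, L2 (grad v i)) ->
  grad_norm_sq Omega (jet_sub w v) = gram w w - 2 * gram w v + gram v v.
Proof.
move=> Lw Lv.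
have subE i : grad (jet_sub w v) i = (fun x => 1 * grad w i x + (- 1) * grad v i x).
  by apply/funext => x; rewrite /= mul1r.
rewrite grad_norm_sqE => [|i]; last by rewrite subE; exact: in_L2_lin.
rewrite {1}/gram; under eq_bigr => i _ do rewrite subE.
rewrite /gram mulr_sumr -sumrN -!big_split; apply: eq_bigr => i _.
have Li := in_L2_lin mOmega 1 (- 1) (Lw i) (Lv i).
rewrite (dot_linl mOmega) // !(dot_linr mOmega) // (dotC _ (grad v i) (grad w i)) /=; ring.
Qed.

(** Expansion of the squared norm of the gradient of [w - 2 v + u]. *)
Lemma gram_second_difference (w v u : jet2 R d) :
  (forall i, L2 (grad w i)) -> (forall i, L2 (grad v i)) -> (forall i, L2 (grad u i)) ->
  0 <= gram w w + 4 * gram v v + gram u u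
       - 4 * gram w v - 4 * gram v u + 2 * gram w u.
Proof.
move=> Lw Lv Lu.
rewrite /gram !mulr_sumr -!sumrN -!big_split /=; apply: sumr_ge0 => i _.
have L1 := in_L2_lin mOmega 1 (- 2) (Lw i) (Lv i).
have L3 := in_L2_lin mOmega 1 1 L1 (Lu i).
have := dot_ge0 Omega (fun x => 1 * (1 * grad w i x + (- 2) * grad v i x) + 1 * grad u i x).
rewrite (dot_linl mOmega) // (dot_linl mOmega) // !(dot_linr mOmega) //.
rewrite (dotC _ (grad v i) (grad w i)).
rewrite (dotC _ (grad u i) (grad w i)) (dotC _ (grad u i) (grad v i)).
congr (0 <= _); ring.
Qed.

Lemma dot_ae0 (f g : 'rV[R]_d -> R) : L2 f -> L2 g ->
  {ae mu, forall x, Omega x -> f x = 0} -> dot Omega f g = 0.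
Proof.
move=> Lf Lg f0; have := integrable_mul mOmega Lf Lg; move/integrableP => [mfg _].
rewrite /dot /Rintegral (@ae_eq_integral _ _ _ mu Omega (cst 0%E)) ?integral0 //.
by apply: filterS f0 => x fx Ox; rewrite /= fx // mul0r.
Qed.

End dot_fields.

Lemma smooth_partial (R : realType) (d : nat) (f : 'rV[R]_d -> R) (i : 'I_d) :
  smooth f -> smooth (partial i f).
Proof. by move=> sf k; have [_ /(_ i)[]] := sf k.+1. Qed.

(** No boundary term survives. For the Neumann condition this is the vanishing of
the normal trace tested against [v], itself an element of H1. In the periodic
case it is integration by parts for the smooth periodic approximants of [w] and
[v], and both sides are continuous for the L2 convergence of values, gradients
and Hessians. *)
Lemma green_identity (R : realType) (d : nat) (Omega : set 'rV[R]_d)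
    (bc : boundary_condition R d) (w v : jet2 R d) :
  bounded_domain Omega -> compatible_domain Omega bc ->
  in_H2_bc Omega bc w -> in_H2_bc Omega bc v ->
  dot Omega (lap w) (fval v) = - gram Omega w v.
Proof.
move=> [oO _ bO _] cbc [Hw bw] [Hv bv].
have mO := open_measurable_rV oO.
have [Lw Lgw Lhw Llw] := in_H2_L2 mO Hw; have [Lv Lgv Lhv Llv] := in_H2_L2 mO Hv.
case: bc cbc bw bv => [_ bw _|a b [ab OE] [f [sf f0 f1 f2]] [g [sg g0 g1 _]]].
  have := bw (fval v) (grad v) Hv.1; rewrite /normal_trace.
  have [isum sumE] := Rintegral_sum_mul mO (index_enum 'I_d) Lgw Lgv.
  rewrite RintegralD //; last exact: integrable_mul.
  by rewrite sumE => /eqP; rewrite addr_eq0 => /eqP.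
rewrite /gram -sumrN [LHS](dot_suml mO) //; apply: eq_bigr => i _.
have cts h : smooth h -> in_L2 Omega h.
  by move=> sh; apply: continuous_in_L2 => //; exact: (sh 0%N).
have Lf k : smooth (f k) by case: (sf k).
have Lg k : smooth (g k) by case: (sg k).
have lim1 : dot Omega (partial i (partial i (f k))) (g k) @[k --> \oo] -->
    dot Omega (hess w i i) (fval v).
  by apply: dot_cvg => // k; apply: cts; do ?apply: smooth_partial.
have lim2 : - dot Omega (partial i (f k)) (partial i (g k)) @[k --> \oo] -->
    - dot Omega (grad w i) (grad v i).
  apply: cvgN; apply: dot_cvg => // k; apply: cts; exact: smooth_partial.
have ibp : (fun k => dot Omega (partial i (partial i (f k))) (g k)) =
    (fun k => - dot Omega (partial i (f k)) (partial i (g k))).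
  apply/funext => k; have [_ pf] := sf k; have [_ pg] := sg k.
  rewrite OE in bO *; apply: periodic_ibp => //; first exact: smooth_partial.
  exact: periodic_partial.
rewrite -ibp in lim2.
by rewrite -(cvg_lim (@Rhausdorff R) lim1) -(cvg_lim (@Rhausdorff R) lim2).
Qed.

(** * The energy balance of the scheme *)

Section scheme.
Context (R : realType) (d : nat) (Omega : set 'rV[R]_d) (bc : boundary_condition R d).
Context (alpha eps theta tau C0 : R) (F : R -> R) (M : nat).
Context (phi0 : jet2 R d) (phi : nat -> jet2 R d) (r : nat -> R).
Hypothesis domO : bounded_domain Omega.
Hypothesis cbc : compatible_domain Omega bc.
Hypothesis tau_gt0 : 0 < tau.
Hypothesis sol : L1CN_solution Omega bc alpha eps theta tau C0 F M phi0 phi r.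

(** The test function of the energy estimate, in the shape of a linear
combination so that [in_L2_lin] and [dot_linr] apply to it as they stand. *)
Definition increment (n : nat) (x : 'rV[R]_d) : R :=
  1 * fval (phi n.+1) x + (- 1) * fval (phi n) x.

Let mO : measurable Omega.
Proof. by case: domO => oO _ _ _; exact: open_measurable_rV. Qed.

Let H2 n : (n <= M)%N -> in_H2_bc Omega bc (phi n).
Proof. exact: (L1CN_H2 sol). Qed.

Let L2jet n (nM : (n <= M)%N) := in_H2_L2 mO (proj1 (H2 nM)).

Lemma in_L2_increment n : (n < M)%N -> in_L2 Omega (increment n).
Proof.
move=> nM; have [L1 _ _ _] := L2jet nM; have [L0 _ _ _] := L2jet (ltnW nM).
exact: in_L2_lin.
Qed.

Lemma frac_opE n x : frac_op alpha tau phi n x =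
  tau^-1 * \sum_(k < n.+1) btilde alpha tau (n - k) * increment k x.
Proof.
rewrite mulr_sumr; apply: eq_bigr => k _.
by rewrite /increment; ring.
Qed.

Lemma in_L2_frac_op n : (n < M)%N -> in_L2 Omega (frac_op alpha tau phi n).
Proof.
move=> nM.
have Ls : in_L2 Omega (fun x => \sum_(k < n.+1)
    (btilde alpha tau (n - k) * increment k x + 0 * increment k x)).
  apply: in_L2_sum => // k _; have kM : (k < M)%N by rewrite (leq_trans (ltn_ord k)).
  by apply: in_L2_lin => //; exact: in_L2_increment.
apply: in_L2_ext (in_L2_lin mO tau^-1 0 Ls Ls) => x.
rewrite mul0r addr0 frac_opE; congr (_ * _); apply: eq_bigr => k _.
by rewrite mul0r addr0.
Qed.

(** The kernel inequality holds pointwise in space, for the sequence of increments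
at a given point, and is then integrated. *)
Lemma dissipation_ge0 N : 0 < alpha < 1 -> (N <= M)%N ->
  0 <= \sum_(n < N) dot Omega (frac_op alpha tau phi n) (increment n).
Proof.
move=> alpha01 NM.
have Lf (n : 'I_N) : in_L2 Omega (frac_op alpha tau phi n).
  by apply: in_L2_frac_op; exact: leq_trans (ltn_ord n) NM.
have Lg (n : 'I_N) : in_L2 Omega (increment n).
  by apply: in_L2_increment; exact: leq_trans (ltn_ord n) NM.
have [_ <-] := Rintegral_sum_mul mO (index_enum 'I_N) Lf Lg.
apply: Rintegral_ge0 => x _.
rewrite (eq_bigr (fun n : 'I_N => tau^-1 * (increment n x *
   \sum_(k < n.+1) btilde alpha tau (n - k) * increment k x))); last first.
  by move=> n _; rewrite frac_opE -mulrA [X in _ * X]mulrC.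
rewrite -mulr_sumr mulr_ge0 ?invr_ge0 ?(ltW tau_gt0) //.
exact: (btilde_form_ge0 _ alpha tau (fun n => increment n x) N alpha01).
Qed.

Lemma dot_lap_increment m n : (m <= M)%N -> (n < M)%N ->
  dot Omega (lap (phi m)) (increment n) =
  gram Omega (phi m) (phi n) - gram Omega (phi m) (phi n.+1).
Proof.
move=> mM nM; have [L1 _ _ _] := L2jet nM; have [L0 _ _ _] := L2jet (ltnW nM).
have [_ _ _ Ll] := L2jet mM.
rewrite (dot_linr mO) //.
rewrite (green_identity domO cbc (H2 mM) (H2 nM)).
rewrite (green_identity domO cbc (H2 mM) (H2 (ltnW nM))); ring.
Qed.

Lemma lap_add (w v : jet2 R d) x : lap (jet_add w v) x = lap w x + lap v x.
Proof. by rewrite /lap -big_split. Qed.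

Lemma lap_scale c (w : jet2 R d) x : lap (jet_scale c w) x = c * lap w x.
Proof. by rewrite /lap mulr_sumr. Qed.

Lemma lap_phi_half n x : lap (phi_half phi n) x =
  3 / 2 * lap (phi n) x + (- 1 / 2) * lap (phi n.-1) x.
Proof. by rewrite /phi_half /jet_sub !(lap_add, lap_scale) /prev; field. Qed.

(** Test the evolution equation with [phi^{n+1} - phi^n]. By the equation for [r],
the nonlinear term together with the part of the stabilization that carries the
factor [q] is exactly [r n.+1 ^ 2 - r n ^ 2]; the diffusion is the increment of
[eps^2 / 2] times the squared gradient norm. The extrapolated term
[theta * Delta phi^{n+1/2}] is compared with the theta-terms of the energy: the
difference is [theta / 4] times the squared norm of the gradient of the second
difference [phi^{n+1} - 2 phi^n + phi^{n-1}]. *)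
Lemma energy_step n : 0 <= theta -> (n < M)%N ->
  discrete_energy Omega eps theta phi r n.+1 +
    dot Omega (frac_op alpha tau phi n) (increment n) <=
  discrete_energy Omega eps theta phi r n.
Proof.
move=> theta_ge0 nM.
have n0M := ltnW nM; have pM : (n.-1 <= M)%N by exact: leq_trans (leq_pred n) n0M.
have [_ g1 _ l1] := L2jet nM; have [_ g0 _ l0] := L2jet n0M; have [_ gp _ lp] := L2jet pM.
have Ld := in_L2_increment nM; have Lfr := in_L2_frac_op nM.
have := L1CN_phi sol nM; have := L1CN_r sol nM; have := L1CN_dF sol nM; rewrite /=.
set w := phi_half phi n; set s := Num.sqrt _; set q := (r n.+1 + r n) / _.
set dF := fun x => derive1 F (fval w x); move=> LdF r_eq phi_eq.
have Llw := in_L2_lin mO (3 / 2) (- 1 / 2) l0 lp.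
have Llw' : in_L2 Omega (lap w) by apply: in_L2_ext Llw => x; rewrite lap_phi_half.
have Lavg := in_L2_lin mO 1 1 l1 l0.
have Lnl := in_L2_lin mO ((1 - q) * theta) q Llw' LdF.
have Lrhs := in_L2_lin mO (- (eps ^+ 2 / 2)) 1 Lavg Lnl.
have dot_lapw : dot Omega (lap w) (increment n) =
    3 / 2 * dot Omega (lap (phi n)) (increment n) +
    (- 1 / 2) * dot Omega (lap (phi n.-1)) (increment n).
  by rewrite -dot_linl //; apply: eq_Rintegral => x _; rewrite lap_phi_half.
have test_eq : dot Omega (frac_op alpha tau phi n) (increment n)
    - eps ^+ 2 / 2 * (dot Omega (lap (phi n.+1)) (increment n) +
                      dot Omega (lap (phi n)) (increment n))
    + (1 - q) * theta * dot Omega (lap w) (increment n)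
    + q * dot Omega dF (increment n) = 0.
  rewrite -(dot_ae0 mO (in_L2_lin mO 1 1 Lfr Lrhs) Ld); last first.
    apply: filterS phi_eq => x + Ox => /(_ Ox) <-.
    by rewrite lap_add /dF; field.
  rewrite (dot_linl mO) // (dot_linl mO) // (dot_linl mO) // (dot_linl mO) //.
  by ring.
have r_sq : q * (- theta * dot Omega (lap w) (increment n) + dot Omega dF (increment n)) =
    r n.+1 ^+ 2 - r n ^+ 2.
  have -> : r n.+1 ^+ 2 - r n ^+ 2 = (r n.+1 + r n) * (tau * ((r n.+1 - r n) / tau)).
    by field; rewrite gt_eqF.
  have LF := in_L2_lin mO (- theta) 1 Llw' LdF.
  rewrite r_eq (_ : \int[_]_(_ in _) _ = tau^-1 *
    (- theta * dot Omega (lap w) (increment n) + dot Omega dF (increment n))).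
    rewrite /q div1r; set c := _^-1; set X := _ + dot _ _ _.
    transitivity ((r n.+1 + r n) * c * X * (tau / tau)); last by ring.
    by rewrite divff ?gt_eqF // mulr1.
  rewrite -[X in _ + X]mul1r -(dot_linl mO) //.
  transitivity (dot Omega (fun x => - theta * lap w x + 1 * dF x)
    (fun x => tau^-1 * increment n x + 0 * increment n x)).
    by apply: eq_Rintegral => x _; rewrite /dF /increment; ring.
  by rewrite (dot_linr mO) // mul0r addr0.
rewrite /discrete_energy /prev /= !(grad_norm_sq_sub mO) // !(grad_norm_sqE mO) //.
rewrite !real_normK ?num_real //.
have := gram_second_difference mO g1 g0 gp.
move/(mulr_ge0 theta_ge0).
move: test_eq r_sq; rewrite dot_lapw !dot_lap_increment //.
rewrite (gramC _ (phi n) (phi n.+1)) (gramC _ (phi n.-1) (phi n)) (gramC _ (phi n.-1) (phi n.+1)).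
move=> test_eq r_sq sd_ge0; rewrite -subr_ge0.
set lhs := (X in 0 <= X).
suff -> : lhs = 4^-1 * (theta * (gram Omega (phi n.+1) (phi n.+1) +
    4 * gram Omega (phi n) (phi n) + gram Omega (phi n.-1) (phi n.-1)
    - 4 * gram Omega (phi n.+1) (phi n) - 4 * gram Omega (phi n) (phi n.-1)
    + 2 * gram Omega (phi n.+1) (phi n.-1))) by rewrite mulr_ge0.
move: test_eq r_sq; rewrite /lhs => test_eq r_sq; lra.
Qed.

Lemma energy_sum N : 0 <= theta -> (N <= M)%N ->
  discrete_energy Omega eps theta phi r N +
    \sum_(n < N) dot Omega (frac_op alpha tau phi n) (increment n) <=
  discrete_energy Omega eps theta phi r 0.
Proof.
move=> theta_ge0; elim: N => [|N IH] NM; first by rewrite big_ord0 addr0.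
rewrite big_ord_recr /= addrCA addrC; apply: le_trans (IH (ltnW NM)).
by rewrite lerD2r; exact: energy_step.
Qed.

End scheme.

Unset Implicit Arguments.
Set Strict Implicit.

Theorem theorem4p1 (R : realType) (d : nat) (Omega : set 'rV[R]_d)
    (bc : boundary_condition R d) (alpha eps theta T C0 : R) (F : R -> R)
    (M : nat) (phi0 : jet2 R d) (phi : nat -> jet2 R d) (r : nat -> R) :
  (1 <= d <= 3)%N ->
  bounded_domain Omega ->
  compatible_domain Omega bc ->
  0 < alpha < 1 ->
  0 < eps ->
  0 <= theta <= eps ^+ 2 ->
  0 < T ->
  (0 < M)%N ->
  (forall s, derivable F s 1) ->
  (forall w, admissible Omega bc F w -> 0 < energy Omega F theta w + C0) ->
  L1CN_solution Omega bc alpha eps theta (T / M%:R) C0 F M phi0 phi r ->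
  forall n, (1 <= n <= M)%N ->
    discrete_energy Omega eps theta phi r n <=
    discrete_energy Omega eps theta phi r 0.
Proof.
move=> _ domO cbc alpha01 _ /andP[theta_ge0 _] T_gt0 M_gt0 _ _ sol n /andP[_ nM].
have tau_gt0 : 0 < T / M%:R by rewrite divr_gt0 ?ltr0n.
apply: le_trans (energy_sum domO cbc tau_gt0 sol theta_ge0 nM).
by rewrite lerDl; exact: (dissipation_ge0 domO tau_gt0 sol alpha01 nM).
Qed.
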